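(* For $A, B \in M_+(n,\mathbb{C})$ and an integer $m \geq 2$, we have $$\int_0^1 A\#_{\nu}B\,d\nu \leq \frac{1}{m} \left(\sum_{k=0}^m A\#_{k/m}B -\frac{A+B}{2}\right)\leq \frac{1}{m}\sum_{k=0}^{m-1}A\#_{k/(m-1)}B \leq \frac{A+B}{2}.$$
   Context: $M_+(n,\mathbb{C})$ is the set of all $n\times n$ positive semidefinite complex matrices. For $0\le\nu\le1$, $A\#_{\nu}B \equiv A^{1/2}(A^{-1/2}BA^{-1/2})^{\nu}A^{1/2}$ is the $\nu$-weighted geometric mean introduced by Kubo and Ando, with the usual convention $T^0=I$ for positive semidefinite $T$. Inequalities between Hermitian matrices are in the Loewner order ($S\le T$ means $T-S$ is positive semidefinite). Powers are defined by the functional calculus and the integral is taken entrywise. *)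

(* Defs.v *)
From HB Require Import structures.
From mathcomp Require Import all_boot all_order all_algebra.
From mathcomp Require Import complex.
From mathcomp Require Import all_classical all_reals all_analysis.

Set Implicit Arguments.
Unset Strict Implicit.
Unset Printing Implicit Defensive.

Import Order.TTheory GRing.Theory Num.Theory.
Import numFieldNormedType.Exports.

Local Open Scope classical_set_scope.
Local Open Scope ring_scope.
Local Open Scope complex_scope.
Local Open Scope sesquilinear_scope.

Definition psdmx (R : realType) (n : nat) (A : 'M[R[i]]_n) : Prop :=
  A \is hermsymmx /\ forall v : 'cV[R[i]]_n, 0 <= (v^t* *m A *m v) 0 0.

Definition loewner_le (R : realType) (n : nat) (S T : 'M[R[i]]_n) : Prop :=
  psdmx (T - S).

(* Meaningful for Hermitian A, whose eigenvalues are real: the real part only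
   moves them from R[i] to R. *)
Definition mxcalc (R : realType) (n : nat) (f : R -> R) (A : 'M[R[i]]_n) :
    'M[R[i]]_n :=
  invmx (spectralmx A)
    *m diag_mx (map_mx (fun z : R[i] => (f (complex.Re z))%:C) (spectral_diag A))
    *m spectralmx A.

(* Since 0 `^ 0 = 1, mxpow T 0 is the identity even if T is singular. *)
Definition mxpow (R : realType) (n : nat) (A : 'M[R[i]]_n) (r : R) :
    'M[R[i]]_n :=
  mxcalc (fun x : R => x `^ r) A.

Definition gmean_formula (R : realType) (n : nat) (nu : R)
    (A B : 'M[R[i]]_n) : 'M[R[i]]_n :=
  mxpow A 2^-1
    *m mxpow (mxpow A (- 2^-1) *m B *m mxpow A (- 2^-1)) nu
    *m mxpow A 2^-1.

(* Applies a real-valued functional (a limit, an integral) to the real and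
   imaginary parts of every entry of a matrix-valued function. *)
Definition entrywise (R : realType) (n : nat) (L : (R -> R) -> R)
    (F : R -> 'M[R[i]]_n) : 'M[R[i]]_n :=
  \matrix_(i, j) (L (fun t => complex.Re (F t i j))
                  +i* L (fun t => complex.Im (F t i j))).

(* If A is singular then A^(-1/2) does not exist and A #_nu B is the Kubo-Ando
   mean lim_(e -> 0+) (A + e I) #_nu (B + e I). *)
Definition gmean (R : realType) (n : nat) (nu : R) (A B : 'M[R[i]]_n) :
    'M[R[i]]_n :=
  if A \in unitmx then gmean_formula nu A B
  else entrywise (fun f : R -> R => lim (f e @[e --> 0^'+]))
         (fun e => gmean_formula nu (A + (e%:C)%:M) (B + (e%:C)%:M)).

Definition mxintegral01 (R : realType) (n : nat) (F : R -> 'M[R[i]]_n) :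
    'M[R[i]]_n :=
  entrywise
    (fun f : R -> R => \int[@lebesgue_measure R]_(t in `[0, 1]) f t) F.

(* Main.v *)
(* For positive definite A and positive semidefinite B there are an invertible T
   and a real diagonal D >= 0 with A = T^* T, B = T^* D T and
   A #_nu B = T^* D^nu T for all nu.  Hence nu |-> v^* (A #_nu B) v is, for every
   vector v, a nonnegative combination of the convex functions d^nu, and the
   three inequalities reduce to inequalities for a convex function g on [0, 1]:
   the trapezoid rule overestimates the integral; each g(k/m) is bounded by
   interpolating between the nodes (k-1)/(m-1) and k/(m-1); each g(k/(m-1)) is
   bounded by the chord through g(0) and g(1).

   For singular A one passes to the limit e -> 0+ in (A + e) #_nu (B + e), which
   exists because the mean is jointly monotone.  Monotonicity at nu = 1/2 comes
   from the Riccati equation X A^-1 X = B satisfied by X = A #_{1/2} B; it extends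
   to all nu by bisection, since T^* D^((mu + nu)/2) T is the midpoint mean of
   T^* D^mu T and T^* D^nu T, and by continuity in nu. *)
Require Import Defs.
From HB Require Import structures.
From mathcomp Require Import all_boot all_order all_algebra.
From mathcomp Require Import complex.
From mathcomp Require Import all_classical all_reals all_analysis.
From mathcomp Require Import measurable_realfun ring lra.

Set Implicit Arguments.
Unset Strict Implicit.
Unset Printing Implicit Defensive.

Import Order.TTheory GRing.Theory Num.Theory.
Import numFieldNormedType.Exports.

Local Open Scope classical_set_scope.
Local Open Scope ring_scope.
Local Open Scope complex_scope.
Local Open Scope sesquilinear_scope.

(** * Hermitian matrices and their quadratic forms *)

Section QuadraticForm.
Context {R : realType}.
Notation C := R[i].

Lemma adjmxM m n p (A : 'M[C]_(m, n)) (B : 'M[C]_(n, p)) :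
  (A *m B)^t* = B^t* *m A^t*.
Proof. by rewrite trmx_mul map_mxM. Qed.

Lemma adjmxD m n (A B : 'M[C]_(m, n)) : (A + B)^t* = A^t* + B^t*.
Proof. by rewrite linearD map_mxD. Qed.

Lemma adjmxN m n (A : 'M[C]_(m, n)) : (- A)^t* = - A^t*.
Proof. by rewrite linearN map_mxN. Qed.

Lemma adjmxZ m n (c : R) (A : 'M[C]_(m, n)) : (c%:C *: A)^t* = c%:C *: A^t*.
Proof. by rewrite linearZ map_mxZ; congr (_ *: _); apply: conjc_real. Qed.

Lemma adjmx_diag n (d : 'rV[R]_n) :
  (diag_mx (map_mx (real_complex R) d))^t* =
  diag_mx (map_mx (real_complex R) d).
Proof.
rewrite tr_diag_mx map_diag_mx; congr diag_mx; apply/matrixP => i j.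
by rewrite !mxE; apply: conjc_real.
Qed.

Lemma hermE n (A : 'M[C]_n) : (A \is hermsymmx) = (A^t* == A).
Proof. by rewrite is_hermitianmxE expr0 scale1r eq_sym. Qed.

Lemma hermP n (A : 'M[C]_n) : reflect (A^t* = A) (A \is hermsymmx).
Proof. by rewrite hermE; apply: eqP. Qed.

Lemma herm_congr m n (T : 'M[C]_(m, n)) (M : 'M[C]_m) :
  M \is hermsymmx -> T^t* *m M *m T \is hermsymmx.
Proof. by move=> /hermP hM; apply/hermP; rewrite !adjmxM trmxCK hM mulmxA. Qed.

Lemma hermD n (A B : 'M[C]_n) :
  A \is hermsymmx -> B \is hermsymmx -> A + B \is hermsymmx.
Proof. by move=> /hermP hA /hermP hB; apply/hermP; rewrite adjmxD hA hB. Qed.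

Lemma hermN n (A : 'M[C]_n) : A \is hermsymmx -> - A \is hermsymmx.
Proof. by move=> /hermP hA; apply/hermP; rewrite adjmxN hA. Qed.

Lemma hermB n (A B : 'M[C]_n) :
  A \is hermsymmx -> B \is hermsymmx -> A - B \is hermsymmx.
Proof. by move=> hA hB; exact: (hermD hA (hermN hB)). Qed.

Lemma hermZ n (c : R) (A : 'M[C]_n) :
  A \is hermsymmx -> c%:C *: A \is hermsymmx.
Proof. by move=> /hermP hA; apply/hermP; rewrite adjmxZ hA. Qed.

Lemma herm_diag n (d : 'rV[R]_n) :
  diag_mx (map_mx (real_complex R) d) \is hermsymmx.
Proof. by apply/hermP; rewrite adjmx_diag. Qed.

Lemma herm_scalar n (c : R) : ((c%:C)%:M : 'M[C]_n) \is hermsymmx.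
Proof.
rewrite -diag_const_mx; have <- : map_mx (real_complex R) (const_mx c) =
    const_mx c%:C :> 'rV[C]_n by apply/matrixP => i j; rewrite !mxE.
exact: herm_diag.
Qed.

Lemma herm_sum n (I : Type) (r : seq I) (P : pred I) (F : I -> 'M[C]_n) :
  (forall i, P i -> F i \is hermsymmx) ->
  \sum_(i <- r | P i) F i \is hermsymmx.
Proof.
move=> hF; elim/big_rec: _ => [|i M Pi hM]; last exact: hermD (hF _ Pi) hM.
by apply/hermP; rewrite trmx0 map_mx0.
Qed.

Lemma herm_entry n (M : 'M[C]_n) i j :
  M \is hermsymmx -> M j i = (M i j)^*.
Proof. by move=> /hermP /matrixP /(_ j i) <-; rewrite !mxE. Qed.

(** For Hermitian [M] the form is already real ([rqK]), so the real part loses nothing there and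
    Loewner comparisons become comparisons in [R]. *)
Definition rq n (M : 'M[C]_n) (v : 'cV[C]_n) : R :=
  complex.Re ((v^t* *m M *m v) 0 0).

Lemma rqK n (M : 'M[C]_n) v : M \is hermsymmx ->
  (v^t* *m M *m v) 0 0 = (rq M v)%:C.
Proof.
move=> hM; rewrite /rq RRe_real // CrealE.
have /hermP /matrixP /(_ 0 0) := herm_congr v hM.
by rewrite !mxE => ->.
Qed.

Lemma rqD n (M N : 'M[C]_n) v : rq (M + N) v = rq M v + rq N v.
Proof. by rewrite /rq mulmxDr mulmxDl mxE raddfD. Qed.

Lemma rqN n (M : 'M[C]_n) v : rq (- M) v = - rq M v.
Proof. by rewrite /rq mulmxN mulNmx mxE raddfN. Qed.

Lemma rqB n (M N : 'M[C]_n) v : rq (M - N) v = rq M v - rq N v.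
Proof. by rewrite rqD rqN. Qed.

Lemma rqZ n (c : R) (M : 'M[C]_n) v : rq (c%:C *: M) v = c * rq M v.
Proof.
rewrite /rq -scalemxAr -scalemxAl mxE.
by case: (_ 0 0) => a b /=; rewrite mul0r subr0.
Qed.

Lemma rq_sum n (I : Type) (r : seq I) (P : pred I) (F : I -> 'M[C]_n) v :
  rq (\sum_(i <- r | P i) F i) v = \sum_(i <- r | P i) rq (F i) v.
Proof.
elim/big_rec2: _ => [|i y M _ <-]; last by rewrite rqD.
by rewrite /rq mulmx0 mul0mx mxE.
Qed.

Lemma rq_congr m n (T : 'M[C]_(m, n)) (M : 'M[C]_m) v :
  rq (T^t* *m M *m T) v = rq M (T *m v).
Proof. by rewrite /rq adjmxM !mulmxA. Qed.

Definition normsq (z : C) : R := complex.Re z ^+ 2 + complex.Im z ^+ 2.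

Lemma normsq_ge0 z : 0 <= normsq z.
Proof. by rewrite addr_ge0 ?sqr_ge0. Qed.

Lemma normsq_eq0 z : (normsq z == 0) = (z == 0).
Proof.
case: z => a b; rewrite /normsq /= paddr_eq0 ?sqr_ge0 //.
by rewrite !sqrf_eq0 eq_complex.
Qed.

Lemma rq_diag n (d : 'rV[R]_n) v :
  rq (diag_mx (map_mx (real_complex R) d)) v = \sum_i d 0 i * normsq (v i 0).
Proof.
rewrite /rq mxE raddf_sum; apply: eq_bigr => i _.
rewrite mul_mx_diag !mxE.
case: (v i 0) => a b; rewrite /normsq /= /=; ring.
Qed.

Lemma psdmxP n (M : 'M[C]_n) :
  psdmx M <-> M \is hermsymmx /\ forall v, 0 <= rq M v.
Proof.
by split=> -[hM M0]; split=> // v; have := M0 v; rewrite rqK // ler0c.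
Qed.

Lemma loewner_leP n (S T : 'M[C]_n) : S \is hermsymmx -> T \is hermsymmx ->
  loewner_le S T <-> forall v, rq S v <= rq T v.
Proof.
move=> hS hT; rewrite /loewner_le psdmxP; split.
  by move=> -[_ le0] v; have := le0 v; rewrite rqB subr_ge0.
by move=> leST; split=> [|v]; [exact: hermB | rewrite rqB subr_ge0].
Qed.

(** The two cross terms are complex conjugates because [M] is Hermitian, so they add up to twice a
    real part. *)
Lemma rq_add n (M : 'M[C]_n) u v : M \is hermsymmx ->
  rq M (u + v) = rq M u + rq M v + 2 * complex.Re ((u^t* *m M *m v) 0 0).
Proof.
move=> hM; have E : (u + v)^t* *m M *m (u + v) =
    u^t* *m M *m u + v^t* *m M *m u + (u^t* *m M *m v + v^t* *m M *m v).
  by rewrite adjmxD mulmxDr !mulmxDl.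
have : (v^t* *m M *m u) 0 0 = ((u^t* *m M *m v) 0 0)^*.
  rewrite -[in LHS](hermP _ hM) -[in LHS](trmxCK u) -adjmxM.
  by rewrite -mulmxA -adjmxM [LHS]mxE; congr (_^*); rewrite [LHS]mxE.
rewrite /rq E; move: (u^t* *m M *m u) (v^t* *m M *m u) (u^t* *m M *m v).
move: (v^t* *m M *m v) => a b c d bd; rewrite !mxE bd !raddfD /=.
by case: (d 0 0) => x y /=; ring.
Qed.

Lemma entryE n (M : 'M[C]_n) i j :
  ((delta_mx i 0 : 'cV[C]_n)^t* *m M *m (delta_mx j 0 : 'cV[C]_n)) 0 0 = M i j.
Proof.
rewrite (_ : (delta_mx i 0 : 'cV[C]_n)^t* = (delta_mx 0 i : 'rV[C]_n)).
  by rewrite -rowE -colE !mxE.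
by apply/matrixP => a b; rewrite !mxE andbC; apply: conjc_nat.
Qed.

(** Polarization: this and [Im_entry] recover the entries from the quadratic form, so that
    convergence or integrability of all forms passes to the entries. *)
Lemma Re_entry n (M : 'M[C]_n) i j : M \is hermsymmx ->
  complex.Re (M i j) = 2^-1 * (rq M (delta_mx i 0 + delta_mx j 0)
     - rq M (delta_mx i 0) - rq M (delta_mx j 0)).
Proof. by move=> hM; rewrite rq_add // entryE; field. Qed.

(** The factor ['i] turns the cross term into ['i * M i j], whose real part is minus the imaginary
    part of the entry; hence the sign. *)
Lemma Im_entry n (M : 'M[C]_n) i j : M \is hermsymmx ->
  complex.Im (M i j) = - 2^-1 * (rq M (delta_mx i 0 + 'i *: delta_mx j 0)
     - rq M (delta_mx i 0) - rq M ('i *: delta_mx j 0)).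
Proof.
move=> hM.
have scaleE (x : 'M[C]_1) : ('i *: x) 0 0 = 'i * x 0 0 by rewrite mxE.
by rewrite rq_add // -scalemxAr mxE entryE (mulrC 'i) ReiNIm; field.
Qed.

Lemma rq_entries n (M : 'M[C]_n) v :
  rq M v = \sum_i \sum_j
    (complex.Re ((v i 0)^* * v j 0) * complex.Re (M i j)
     - complex.Im ((v i 0)^* * v j 0) * complex.Im (M i j)).
Proof.
rewrite /rq mxE raddf_sum exchange_big; apply: eq_bigr => j _ /=.
rewrite mxE mulr_suml raddf_sum; apply: eq_bigr => i _ /=.
rewrite !mxE; case: (v i 0) => a b; case: (v j 0) => c d.
by case: (M i j) => e f /=; ring.
Qed.

End QuadraticForm.

(** * Functional calculus and the diagonal form of the mean *)

Section FunctionalCalculus.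
Context {R : realType} {n : nat}.
Notation C := R[i].
Implicit Types (A B T : 'M[C]_n) (d : 'rV[R]_n).

Definition rdiag d : 'M[C]_n := diag_mx (map_mx (real_complex R) d).

Lemma rdiagM d1 d2 :
  rdiag d1 *m rdiag d2 = rdiag (\row_i (d1 0 i * d2 0 i)).
Proof.
rewrite /rdiag mulmx_diag; congr diag_mx.
by apply/matrixP => i j; rewrite !mxE rmorphM.
Qed.

Lemma rdiag1 d : (forall i, d 0 i = 1) -> rdiag d = 1%:M.
Proof.
move=> d1; rewrite /rdiag -diag_const_mx; congr diag_mx.
by apply/matrixP => i j; rewrite !mxE ord1 d1.
Qed.

Definition spec A : 'rV[R]_n := map_mx (@complex.Re R) (spectral_diag A).

Lemma mxcalcE (f : R -> R) A :
  mxcalc f A = (spectralmx A)^t* *m rdiag (map_mx f (spec A)) *m spectralmx A.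
Proof.
rewrite /mxcalc (invmx_unitary (spectral_unitarymx A)) /rdiag /spec.
by rewrite -!map_mx_comp.
Qed.

Lemma eq_mxcalc (f g : R -> R) A :
  (forall i, f (spec A 0 i) = g (spec A 0 i)) -> mxcalc f A = mxcalc g A.
Proof.
move=> fg; rewrite !mxcalcE.
suff -> : map_mx f (spec A) = map_mx g (spec A) by [].
by apply/matrixP => i j; rewrite !mxE ord1; have := fg j; rewrite !mxE.
Qed.

Lemma mxcalc_herm (f : R -> R) A : mxcalc f A \is hermsymmx.
Proof. by rewrite mxcalcE herm_congr ?herm_diag. Qed.

Lemma mxcalcM (f g : R -> R) A :
  mxcalc f A *m mxcalc g A = mxcalc (fun x => f x * g x) A.
Proof.
have assoc (U V D1 D2 : 'M[C]_n) : V *m U = 1%:M ->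
    U *m D1 *m V *m (U *m D2 *m V) = U *m (D1 *m D2) *m V.
  by move=> VU; rewrite -!mulmxA (mulmxA V) VU mul1mx.
rewrite !mxcalcE (assoc _ _ _ _ (unitarymxP (spectral_unitarymx A))) rdiagM.
suff -> : \row_i (map_mx f (spec A) 0 i * map_mx g (spec A) 0 i) =
  map_mx (fun x => f x * g x) (spec A) by [].
by apply/matrixP => i j; rewrite !mxE ord1.
Qed.

Lemma spectral_unitaryC A : (spectralmx A)^t* *m spectralmx A = 1%:M.
Proof.
by rewrite -invmx_unitary ?spectral_unitarymx // mulVmx ?spectral_unit.
Qed.

Lemma mxcalc1 A : mxcalc (fun=> 1) A = 1%:M.
Proof.
rewrite mxcalcE rdiag1 ?mulmx1 ?spectral_unitaryC // => i.
by rewrite !mxE.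
Qed.

Lemma mxcalc_id A : A \is hermsymmx -> mxcalc id A = A.
Proof.
move=> hA; rewrite /mxcalc.
rewrite [RHS](orthomx_spectralP (hermitian_normalmx hA)).
suff -> : map_mx (fun z : C => (id (complex.Re z))%:C) (spectral_diag A) =
  spectral_diag A by [].
apply/matrixP => i j; rewrite mxE RRe_real //.
exact: (mxOverP (hermitian_spectral_diag_real hA)).
Qed.

(** The eigenvalue is the value of the form at the unit eigenvector
    [(spectralmx A)^t* *m delta_mx i 0]. *)
Lemma spec_ge0 A i : psdmx A -> 0 <= spec A 0 i.
Proof.
move=> /psdmxP[hA A0]; have := A0 ((spectralmx A)^t* *m delta_mx i 0).
rewrite -{1}(mxcalc_id hA) mxcalcE rq_congr mulmxA.
rewrite (unitarymxP (spectral_unitarymx A)) mul1mx rq_diag.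
rewrite (bigD1 i) //= big1 => [|j ji].
  by rewrite !mxE !eqxx /normsq /= expr1n expr0n /= !addr0 mulr1.
by rewrite !mxE (negbTE ji) /normsq /= expr0n /= addr0 mulr0.
Qed.

Lemma spec_gt0 A i : psdmx A -> A \in unitmx -> 0 < spec A 0 i.
Proof.
move=> pA uA; rewrite lt_neqAle spec_ge0 // andbT eq_sym.
have /psdmxP[hA _] := pA.
move: uA; rewrite -{1}(mxcalc_id hA) mxcalcE unitmxE !det_mulmx !unitrM.
move=> /andP[/andP[_ +] _]; rewrite det_diag unitfE => /prodf_neq0 /(_ i isT).
by rewrite !mxE; apply: contra => /eqP ->.
Qed.

Lemma mxpow_sqrt A : psdmx A -> mxpow A 2^-1 *m mxpow A 2^-1 = A.
Proof.
move=> pA; have /psdmxP[hA _] := pA.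
rewrite mxcalcM -[RHS](mxcalc_id hA); apply: eq_mxcalc => i.
by rewrite powR12_sqrt ?spec_ge0 // -expr2 sqr_sqrtr ?spec_ge0.
Qed.

Lemma mxpow_sqrtV A : psdmx A -> A \in unitmx ->
  mxpow A 2^-1 *m mxpow A (- 2^-1) = 1%:M.
Proof.
move=> pA uA; rewrite mxcalcM -(mxcalc1 A); apply: eq_mxcalc => i.
have d0 := spec_gt0 i pA uA.
by rewrite powRN mulfV // gt_eqF // powR_gt0.
Qed.

Definition rpow d (s : R) : 'M[C]_n := rdiag (map_mx (fun x => x `^ s) d).

Lemma rpowM d s t : (forall i, 0 < d 0 i) ->
  rpow d s *m rpow d t = rpow d (s + t).
Proof.
move=> d0; rewrite /rpow rdiagM; congr rdiag; apply/matrixP => i j.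
by rewrite !mxE !ord1 powRD // (gt_eqF (d0 _)) implybT.
Qed.

Lemma rpow0 d : rpow d 0 = 1%:M.
Proof. by apply: rdiag1 => i; rewrite mxE powRr0. Qed.

Lemma rpow_herm d s : rpow d s \is hermsymmx.
Proof. exact: herm_diag. Qed.

(** For the [T] and [d] supplied by [gmean_formula_geod] this is the path of weighted means from [A]
    at 0 to [B] at 1. *)
Definition geod T d (nu : R) : 'M[C]_n := T^t* *m rpow d nu *m T.

Lemma geod_herm T d nu : geod T d nu \is hermsymmx.
Proof. exact/herm_congr/rpow_herm. Qed.

Lemma rq_geod T d nu v :
  rq (geod T d nu) v = \sum_i d 0 i `^ nu * normsq ((T *m v) i 0).
Proof. by rewrite rq_congr rq_diag; apply: eq_bigr => i _; rewrite mxE. Qed.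

Lemma psd_congr T A : psdmx A -> psdmx (T^t* *m A *m T).
Proof.
move=> /psdmxP[hA A0]; apply/psdmxP; split; first exact: herm_congr.
by move=> v; rewrite rq_congr.
Qed.

Lemma gmean_formula_herm nu A B : gmean_formula nu A B \is hermsymmx.
Proof.
have /hermP h := mxcalc_herm (fun x => x `^ 2^-1) A.
by rewrite /gmean_formula /mxpow -{1}h herm_congr ?mxcalc_herm.
Qed.

(* With S = A^(1/2) and S^-1 B S^-1 = V^* D V, take T = V S. *)
Lemma gmean_formula_geod A B : psdmx A -> A \in unitmx -> psdmx B ->
  exists T d, [/\ T \in unitmx, forall i, 0 <= d 0 i,
    B \in unitmx -> forall i, 0 < d 0 i,
    A = geod T d 0 /\ B = geod T d 1 &
    forall nu, gmean_formula nu A B = geod T d nu].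
Proof.
move=> pA uA pB.
have SS := mxpow_sqrt pA; have SV := mxpow_sqrtV pA uA.
have [hS hW] : (mxpow A 2^-1)^t* = mxpow A 2^-1 /\
   (mxpow A (- 2^-1))^t* = mxpow A (- 2^-1) by split; apply/hermP/mxcalc_herm.
rewrite /gmean_formula.
set S := mxpow A 2^-1 in SS SV hS *; set W := mxpow A (- 2^-1) in SV hW *.
clearbody S W; 
have [uS uW] := mulmx1_unit SV; have VS := mulmx1C SV.
set M := W *m B *m W.
have pM : psdmx M by rewrite /M -{1}hW; apply: psd_congr.
have /psdmxP[hM _] := pM.
have SMS : S *m M *m S = B by rewrite /M !mulmxA SV mul1mx -mulmxA VS mulmx1.
pose V := spectralmx M.
have E nu : S *m mxpow M nu *m S = geod (V *m S) (spec M) nu.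
  by rewrite /geod adjmxM hS /mxpow mxcalcE !mulmxA.
exists (V *m S), (spec M); split=> //.
- by rewrite unitmx_mul spectral_unit.
- by move=> i; apply: spec_ge0.
- by move=> uB i; apply: spec_gt0 => //; rewrite !unitmx_mul uW uB.
- split.
    rewrite -E -[LHS]SS; congr (_ *m _); rewrite -[LHS]mulmx1 /mxpow.
    rewrite (@eq_mxcalc _ (fun=> 1)) => [|i]; last by rewrite powRr0.
    by rewrite mxcalc1 !mulmx1.
  rewrite -E -[LHS]SMS; congr (_ *m _ *m _); rewrite -[LHS](mxcalc_id hM).
  by apply: eq_mxcalc => i; rewrite powRr1 // spec_ge0.
Qed.

End FunctionalCalculus.

(** * Convex functions on the unit interval *)

Section ConvexOnUnitInterval.
Context {R : realType}.
Notation mu := (@lebesgue_measure R).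
Implicit Types (g : R -> R) (m : nat).

Lemma eq_ler (x y : R) : x = y -> x <= y.
Proof. by move=> ->. Qed.

Definition convex01 g := forall s t l, 0 <= s <= 1 -> 0 <= t <= 1 ->
  0 <= l <= 1 -> g ((1 - l) * s + l * t) <= (1 - l) * g s + l * g t.

(** For [d > 0] this is the convexity of the exponential along [x * ln d]. The base 0, which occurs
    for singular [B], gives the function that is 1 at 0 and 0 elsewhere. *)
Lemma convex01_powR (d : R) : 0 <= d -> convex01 (fun x => d `^ x).
Proof.
move=> d0 s t l /andP[s0 _] /andP[t0 _] /andP[l0 l1].
have l1' : 0 <= 1 - l by rewrite subr_ge0.
rewrite /powR; have [_|dn0] := eqVneq d 0.
  have [st0|_] := eqVneq ((1 - l) * s + l * t) 0; last first.
    by rewrite addr_ge0 // mulr_ge0.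
  (* The left side is 1 only when the combined exponent is 0; then [(1 - l) * s] and [l * t] both
     vanish, and every endpoint with nonzero weight is 0. *)
  move/eqP: st0; rewrite paddr_eq0 ?mulr_ge0 // !mulf_eq0.
  move=> /andP[/orP[/eqP e1|/eqP ->] /orP[/eqP e2|/eqP ->]];
    by rewrite ?eqxx; case: (s == 0); case: (t == 0) => /=; lra.
have l1'' : 1 - l <= 1 by rewrite gerBl.
have := @convex_expR R (Itv01 l1' l1'') (s * ln d) (t * ln d).
rewrite !convRE /= /unstable.onem.
by rewrite !subKr !mulrA -mulrDl.
Qed.

Lemma convex01_sum (I : Type) (r : seq I) (c : I -> R) (F : I -> R -> R) :
  (forall i, 0 <= c i) -> (forall i, convex01 (F i)) ->
  convex01 (fun x => \sum_(i <- r) F i x * c i).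
Proof.
move=> c0 cF s t l s01 t01 l01; rewrite !mulr_sumr -big_split /=.
apply: ler_sum => i _; rewrite !mulrA -mulrDl ler_wpM2r //.
exact: cF.
Qed.

Lemma convex01_chord g t : convex01 g -> 0 <= t <= 1 ->
  g t <= (1 - t) * g 0 + t * g 1.
Proof.
move=> cg t01; have := cg 0 1 t _ _ t01; rewrite mulr0 mulr1 add0r.
by apply; rewrite ?lexx ?ler01.
Qed.

Lemma sum_natr m : \sum_(0 <= k < m) k%:R = m%:R * (m%:R - 1) / 2 :> R.
Proof.
elim: m => [|m IH]; first by rewrite big_geq // !mul0r.
by rewrite big_nat_recr //= IH -natr1; field.
Qed.

Lemma natr_div01 k m : (k <= m)%N -> 0 <= (k%:R / m%:R : R) <= 1.
Proof.
move=> km; rewrite divr_ge0 //=; case: m km => [|m] km.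
  by rewrite invr0 mulr0.
by rewrite ler_pdivrMr ?ltr0n // mul1r ler_nat.
Qed.

(** Each value lies below the chord through the endpoints, and the nodes k/(m-1) have average
    1/2. *)
Lemma grid_le_average g m : (2 <= m)%N -> convex01 g ->
  m%:R^-1 * \sum_(0 <= k < m) g (k%:R / (m%:R - 1)) <= 2^-1 * (g 0 + g 1).
Proof.
case: m => [|[|m]] // _ cg; set M := m.+2; have M0 : 0 < M%:R :> R by [].
have M1 : M%:R - 1 = m.+1%:R :> R by rewrite /M -natr1 addrK.
have M1n0 : m.+1%:R != 0 :> R by rewrite pnatr_eq0.
rewrite ler_pdivrMl // M1.
apply: (@le_trans _ _ (\sum_(0 <= k < M)
    (g 0 + k%:R * ((g 1 - g 0) / m.+1%:R)))).
  rewrite !big_nat; apply: ler_sum => k; rewrite ltnS => /andP[_ km].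
  apply: le_trans (convex01_chord cg (natr_div01 km)) _.
  by apply: eq_ler; field.
rewrite big_split /= -mulr_suml sum_natr M1 sumr_const_nat subn0 -mulr_natl.
by apply: eq_ler; field.
Qed.

(* The node k/m is the convex combination of the coarser nodes (k-1)/(m-1) and
   k/(m-1) with weights k/m and (m-k)/m. *)
Lemma refined_grid_le g m : (2 <= m)%N -> convex01 g ->
  \sum_(0 <= k < m.+1) g (k%:R / m%:R) <=
  (1 + m%:R^-1) * \sum_(0 <= k < m) g (k%:R / (m%:R - 1)).
Proof.
case: m => [|[|m]] // _ cg; set M := m.+2.
have M1 : M%:R - 1 = m.+1%:R :> R by rewrite /M -natr1 addrK.
have Mn0 : M%:R != 0 :> R by rewrite pnatr_eq0.
have M1n0 : m.+1%:R != 0 :> R by rewrite pnatr_eq0.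
rewrite M1; pose h k := g (k%:R / m.+1%:R).
apply: (@le_trans _ _ (\sum_(0 <= k < M.+1)
   (k%:R / M%:R * h k.-1 + (M%:R - k%:R) / M%:R * h k))).
  rewrite !big_nat; apply: ler_sum => k; rewrite ltnS => /andP[_ kM].
  case: k kM => [|k kM].
    by move=> _; rewrite /h !mul0r subr0 add0r mulfV // mul1r.
  (* The last node is treated apart: its right neighbour m/(m-1) lies outside [0, 1], but its weight
     is 0. *)
  have [->|kM'] := eqVneq k.+1 M.
    by rewrite subrr mul0r mul0r addr0 mulfV // mul1r /h /= mulfV.
  have {}kM' : (k.+1 <= m.+1)%N by rewrite -ltnS ltn_neqAle kM' kM.
  have := cg (k.+1%:R / m.+1%:R) (k%:R / m.+1%:R) (k.+1%:R / M%:R).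
  have km : (k <= m.+1)%N by apply: ltnW.
  move=> /(_ (natr_div01 kM') (natr_div01 km) (natr_div01 kM)).
  rewrite [X in g X](_ : _ = k.+1%:R / M%:R) => [le_g|].
    by apply: le_trans le_g _; rewrite /h /=; apply: eq_ler; field.
  have -> : M%:R = m.+1%:R + 1 :> R by rewrite -M1 subrK.
  rewrite -[k.+1%:R]natr1; field.
  by have m0 : 0 <= m%:R :> R by []; rewrite !gt_eqF //; lra.
(* The first sum loses its zero term at k = 0 and is shifted by one; the second loses its zero term
   at k = m. Then [h k] carries the weight (k+1)/m + (m-k)/m = 1 + 1/m. *)
rewrite big_split /= big_nat_recl // mul0r mul0r add0r.
rewrite [X in _ + X]big_nat_recr //= subrr mul0r mul0r addr0.
rewrite -big_split /= mulr_sumr; apply: ler_sum => k _.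
by rewrite -/(h k) -mulrDl -natr1; apply: eq_ler; congr (_ * _); field.
Qed.

(** [refined_grid_le] leaves an excess of 1/m times the coarse sum, which by [grid_le_average] is at
    most the subtracted endpoint term. *)
Lemma refined_trapezoid_le g m : (2 <= m)%N -> convex01 g ->
  m%:R^-1 * (\sum_(0 <= k < m.+1) g (k%:R / m%:R) - 2^-1 * (g 0 + g 1)) <=
  m%:R^-1 * \sum_(0 <= k < m) g (k%:R / (m%:R - 1)).
Proof.
move=> m2 cg; rewrite ler_wpM2l //.
have := refined_grid_le m2 cg; have := grid_le_average m2 cg.
rewrite mulrDl mul1r; lra.
Qed.

Lemma Rintegral_affine (a b c e : R) : a < b ->
  \int[mu]_(x in `[a, b]) (c + e * x) = (b - a) * (c + e * ((a + b) / 2)).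
Proof.
move=> ab; rewrite /Rintegral.
pose F (x : R) := c * x + e / 2 * (x * x).
have dF (x : R) : is_derive x (1 : R) F (c + e * x).
  by rewrite /F; apply: is_derive_eq; rewrite /GRing.scale /=; field.
have cF (x : R) : {for x, continuous F}.
  by apply/differentiable_continuous/derivable1_diffP.
rewrite (@continuous_FTC2 _ (fun x => c + e * x) F a b ab) /F /=.
- by field.
- apply: continuous_subspaceT => x.
  by apply: cvgD; [exact: cvg_cst|apply: cvgMr; exact: cvg_id].
- split; first by move=> x _.
  + exact/cvg_at_right_filter/cF.
  + exact/cvg_at_left_filter/cF.
- by move=> x _; rewrite derive1E derive_val.
Qed.

(** The chord [c + e * x] through the endpoints dominates [g] and is integrated exactly. *)
Lemma le_trapezoid g (a b : R) : a < b ->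
  mu.-integrable `[a, b] (EFin \o g) ->
  (forall l, 0 <= l <= 1 ->
     g ((1 - l) * a + l * b) <= (1 - l) * g a + l * g b) ->
  \int[mu]_(x in `[a, b]) g x <= (b - a) * ((g a + g b) / 2).
Proof.
move=> ab ig cg; have ab0 : 0 < b - a by rewrite subr_gt0.
pose e := (g b - g a) / (b - a); pose c := g a - e * a.
apply: (@le_trans _ _ (\int[mu]_(x in `[a, b]) (c + e * x))).
  apply: le_Rintegral => //.
    apply: continuous_compact_integrable; first exact: segment_compact.
    apply: continuous_subspaceT => x.
    by apply: cvgD; [exact: cvg_cst|apply: cvgMr; exact: cvg_id].
  move=> x /=; rewrite in_itv /= => /andP[ax xb].
  have := cg ((x - a) / (b - a)).
  rewrite divr_ge0 ?subr_ge0 ?(ltW ab) // ler_pdivrMr // mul1r lerD2r xb.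
  move=> /(_ isT); rewrite [X in g X](_ : _ = x); last by field; rewrite gt_eqF.
  move=> /le_trans; apply; rewrite /c /e.
  by apply: eq_ler; field; rewrite gt_eqF.
rewrite Rintegral_affine // /c /e; apply: eq_ler; field; rewrite gt_eqF //.
Qed.

Lemma integral_le_trapezoid g m : (0 < m)%N -> convex01 g ->
  mu.-integrable `[0, 1] (EFin \o g) ->
  \int[mu]_(x in `[0, 1]) g x <=
  m%:R^-1 * (\sum_(0 <= k < m.+1) g (k%:R / m%:R) - 2^-1 * (g 0 + g 1)).
Proof.
move=> m0 cg ig; have m0R : 0 < m%:R :> R by rewrite ltr0n.
have mV : 0 < m%:R^-1 :> R by rewrite invr_gt0.
have igS a b : 0 <= a -> b <= 1 -> mu.-integrable `[a, b] (EFin \o g).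
  move=> a0 b1; apply: integrableS ig => //.
  by apply: subset_itv; rewrite bnd_simp.
(* Induction over the panels: the right side is the composite trapezoid sum on the first [j] of
   them, with both end nodes halved, and equals 0 for [j = 0]. *)
suff main j : (j <= m)%N -> \int[mu]_(x in `[0, j%:R / m%:R]) g x <=
    m%:R^-1 * (\sum_(0 <= k < j.+1) g (k%:R / m%:R)
                - 2^-1 * (g 0 + g (j%:R / m%:R))).
  by have := main m (leqnn _); rewrite mulfV // gt_eqF.
elim: j => [_|j IH jm].
  rewrite mul0r set_itv1 Rintegral_set1 big_nat1 mul0r.
  by rewrite mulr_ge0 ?(ltW mV) //; lra.
pose a : R := j%:R / m%:R; pose b : R := j.+1%:R / m%:R; rewrite -/b.
have /andP[a0 a1] := natr_div01 (ltnW jm); have /andP[b0 b1] := natr_div01 jm.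
rewrite -/a in a0 a1; rewrite -/b in b0 b1.
have ba : b - a = m%:R^-1 by rewrite /a /b -mulrBl -natr1 addrC addKr mul1r.
have ab : a < b by rewrite -subr_gt0 ba.
have := @Rintegral_itvB _ g (BLeft 0) (BRight b) a (igS _ _ (lexx _) b1).
rewrite !bnd_simp => /(_ a0 (ltW ab)).
rewrite Rintegral_itv_obnd_cbnd; last first.
  apply: integrableS (igS a b a0 b1) => //.
  by apply: subset_itvr; rewrite bnd_simp.
move=> /eqP; rewrite subr_eq => /eqP ->.
have := @le_trapezoid g a b ab (igS _ _ a0 b1).
have cgab l : 0 <= l <= 1 ->
    g ((1 - l) * a + l * b) <= (1 - l) * g a + l * g b.
  by apply: cg; apply/andP.
move=> /(_ cgab); rewrite ba; have {IH} := IH (ltnW jm).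
rewrite -/a [in X in _ -> _ -> X]big_nat_recr //= -/b; lra.
Qed.

End ConvexOnUnitInterval.

(** * Joint monotonicity of the mean *)

(** Starting from [0, 1], the half containing [nu] is kept; its endpoints stay good and its length
    is halved each time. *)
Lemma bisection (R : realType) (good : R -> Prop) (nu : R) :
  good 0 -> good 1 -> (forall a b, good a -> good b -> good ((a + b) / 2)) ->
  0 <= nu <= 1 -> forall e : R, 0 < e -> exists a : R, good a /\ ball nu e a.
Proof.
move=> g0 g1 gm /andP[nu0 nu1] e e0.
have bisect k : exists a b, [/\ good a, good b, a <= nu <= b &
    b - a = (2 ^+ k)^-1].
  elim: k => [|k [a [b [ga gb /andP[an nb] ab]]]].
    by exists 0, 1; rewrite nu0 nu1 subr0 expr0 invr1.
  have [nm|mn] := leP nu ((a + b) / 2).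
    exists a, ((a + b) / 2); split=> //; first exact: gm.
      exact/andP.
    by rewrite exprS invfM -ab; field.
  exists ((a + b) / 2), b; split=> //; first exact: gm.
    by rewrite (ltW mn).
  by rewrite exprS invfM -ab; field.
have [k ke] : exists k, (2 ^+ k)^-1 < e.
  exists (Num.truncn e^-1).
  rewrite invf_plt ?posrE ?exprn_gt0 //.
  apply: lt_le_trans (truncnS_gt _) _.
  by rewrite -natrX ler_nat ltn_expl.
have [a [b [ga _ /andP[an nb] ab]]] := bisect k.
by exists a; split=> //; rewrite /ball /= ger0_norm ?subr_ge0 //; lra.
Qed.

Lemma midpoint_closed_ge0 (R : realType) (good : R -> Prop) (h : R -> R) nu :
  good 0 -> good 1 -> (forall a b, good a -> good b -> good ((a + b) / 2)) ->
  0 <= nu <= 1 -> {for nu, continuous h} -> (forall a, good a -> 0 <= h a) ->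
  0 <= h nu.
Proof.
move=> g0 g1 gm nu01 ch gh; rewrite leNgt; apply/negP => hnu.
have : \forall x \near nu, h x < 0 by exact: (cvgr_lt _ ch).
move=> /nbhs_ballP[e /= e0 He].
have [a [ga /He]] := bisection g0 g1 gm nu01 e0.
by rewrite /= ltNge gh.
Qed.

Section Monotonicity.
Context {R : realType} {n : nat}.
Notation C := R[i].
Implicit Types (A B K P S T X : 'M[C]_n) (d : 'rV[R]_n) (u v : 'cV[C]_n).

Lemma rq_scale M (c : R) v : rq (M : 'M[C]_n) (c%:C *: v) = c ^+ 2 * rq M v.
Proof.
rewrite /rq adjmxZ -scalemxAr -!scalemxAl.
have E (x : 'M[C]_1) : complex.Re ((c%:C *: x) 0 0) = c * complex.Re (x 0 0).
  by rewrite mxE; case: (x 0 0) => a b /=; ring.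
by rewrite !E mulrA.
Qed.

Lemma herm_inv P K : P \is hermsymmx -> P *m K = 1%:M -> K \is hermsymmx.
Proof.
move=> /hermP hP PK; apply/hermP.
have KP : K^t* *m P = 1%:M by rewrite -{1}hP -adjmxM PK trmx1 map_mx1.
by rewrite -[LHS]mulmx1 -PK mulmxA KP mul1mx.
Qed.

Lemma rq_inv P K v : P \is hermsymmx -> P *m K = 1%:M ->
  rq P (K *m v) = rq K v.
Proof.
move=> hP PK; have /hermP hK := herm_inv hP PK.
by rewrite -rq_congr hK -mulmxA PK mulmx1.
Qed.

(** Inversion reverses the order. Expanding the form of [P] at [K' v - K v] gives
    [0 <= rq P (K' v) - 2 * rq K' v + rq K v], and [rq P (K' v)] is at most
    [rq P' (K' v) = rq K' v]. *)
Lemma rq_inv_le P P' K K' : psdmx P -> P' \is hermsymmx ->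
  P *m K = 1%:M -> P' *m K' = 1%:M ->
  (forall v, rq P v <= rq P' v) -> forall v, rq K' v <= rq K v.
Proof.
move=> /psdmxP[hP P0] hP' PK PK' PP' v.
have := P0 (K' *m v + (-1)%:C *: (K *m v)).
rewrite rq_add // rq_scale sqrrN expr1n mul1r (rq_inv _ hP PK).
rewrite -scalemxAr adjmxM -(mulmxA _ P) (mulmxA P) PK mul1mx.
rewrite (hermP _ (herm_inv hP' PK')).
have := PP' (K' *m v); rewrite (rq_inv _ hP' PK').
have -> : complex.Re (((-1)%:C *: (v^t* *m K' *m v)) 0 0) = - rq K' v.
  by rewrite mxE /rq; case: ((v^t* *m K' *m v) 0 0) => a b /=; ring.
by move: (rq P _) (rq K v) (rq K' v) => a b c; lra.
Qed.

Lemma psd_eigen (H : 'M[C]_n) : H \is hermsymmx ->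
  (forall (l : R) v, v != 0 -> H *m v = l%:C *: v -> 0 <= l) ->
  forall v, 0 <= rq H v.
Proof.
move=> hH Hl v; rewrite -(mxcalc_id hH) mxcalcE rq_congr rq_diag.
apply: sumr_ge0 => i _; rewrite mulr_ge0 ?normsq_ge0 // mxE /=.
set U := spectralmx H; pose w := U^t* *m (delta_mx i 0 : 'cV[C]_n).
have Uw : U *m w = delta_mx i 0.
  by rewrite mulmxA (unitarymxP (spectral_unitarymx H)) mul1mx.
apply: (Hl _ w).
  apply: contra_eq_neq Uw => ->; rewrite mulmx0.
  apply/eqP => /matrixP /(_ i 0); rewrite !mxE !eqxx => /eqP.
  by rewrite eq_sym oner_eq0.
rewrite -{1}(mxcalc_id hH) mxcalcE -/U -!mulmxA Uw scalemxAr.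
congr (_ *m _); apply/matrixP => j k; rewrite mul_diag_mx !mxE /=.
by have [->|] := eqVneq j i; rewrite ?mulr0.
Qed.

(* If (X' - X) u = l P u, then u^* (X' P^-1 X' - X P^-1 X) u
   = l u^* (X' + X) u, so l has the sign of the left-hand side. *)
Lemma riccati_le P P' K K' X X' Q Q' S :
  S \in unitmx -> P = S^t* *m S -> psdmx P -> P' \is hermsymmx ->
  psdmx X -> X' \is hermsymmx ->
  (forall v, v != 0 -> 0 < rq X' v) ->
  P *m K = 1%:M -> P' *m K' = 1%:M ->
  (forall v, rq P v <= rq P' v) ->
  X *m K *m X = Q -> X' *m K' *m X' = Q' ->
  (forall v, rq Q v <= rq Q' v) ->
  forall v, rq X v <= rq X' v.
Proof.
move=> uS PS pP hP' /psdmxP[hX X0] hX' X'0 PK PK' PP' XKX X'KX' QQ' v.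
have hP : P \is hermsymmx by case/psdmxP: pP.
have hK := herm_inv hP PK.
(* Since [P = S^t* *m S], this congruence turns the generalized problem [(X' - X) u = l P u] into an
   eigenvalue problem for a Hermitian matrix. *)
pose H := (invmx S)^t* *m (X' - X) *m invmx S.
have hH : H \is hermsymmx by apply/herm_congr/hermB.
have SHS : S^t* *m H *m S = X' - X.
  rewrite /H !mulmxA -adjmxM mulVmx // trmx1 map_mx1 mul1mx.
  by rewrite -mulmxA mulVmx // mulmx1.
clearbody H; suff H0 w : 0 <= rq H w by rewrite -subr_ge0 -rqB -SHS rq_congr.
apply: psd_eigen hH _ w => l w w0 Hw.
pose u := invmx S *m w; have Su : S *m u = w by rewrite mulKVmx.
have u0 : u != 0 by apply: contraNneq w0 => u0; rewrite -Su u0 mulmx0.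
have X'u : X' *m u = X *m u + l%:C *: (P *m u).
  rewrite addrC; apply/eqP; rewrite -subr_eq -mulmxBl -SHS -!mulmxA Su.
  by rewrite Hw -scalemxAr PS -mulmxA Su.
(* Order reversal replaces [K'] by [K] on the larger side, leaving [rq K (X u) <= rq K (X' u)] with
   a single inverse. *)
have := QQ' u; have := rq_inv_le pP hP' PK PK' PP' (X' *m u).
have YLY (Y : 'M[C]_n) L :
    Y \is hermsymmx -> rq (Y *m L *m Y) u = rq L (Y *m u).
  by move=> /hermP hY; rewrite -rq_congr hY.
rewrite -XKX -X'KX' (YLY _ _ hX) (YLY _ _ hX') => x'le xle.
have {x'le xle} := le_trans xle x'le.
rewrite X'u rq_add // rq_scale.
have KP : K *m P = 1%:M by apply: mulmx1C.
rewrite (rq_inv _ hK KP).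
have -> : complex.Re (((X *m u)^t* *m K *m (l%:C *: (P *m u))) 0 0)
   = l * rq X u.
  rewrite -scalemxAr -mulmxA (mulmxA K) KP mul1mx adjmxM (hermP _ hX) mxE.
  by rewrite /rq; case: (_ 0 0) => a b /=; ring.
have X'E : rq X' u = rq X u + l * rq P u.
  rewrite /rq -!mulmxA X'u mulmxDr mxE raddfD -scalemxAr; congr (_ + _).
  by rewrite mxE; case: (_ 0 0) => a b /=; ring.
rewrite -addrA lerDl => ge0.
move: (X'0 u u0) (X0 u) ge0; rewrite X'E.
move: (rq X u) (rq P u) => a b x'0 a0.
(* Here [a + l * b] is [rq X' u], which is positive, and [a] is nonnegative, so the factor of [l] is
   positive. *)
rewrite (_ : _ + _ = l * (a + (a + l * b))); last by ring.
by rewrite pmulr_lge0 // ltr_wpDl.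
Qed.

Lemma geod_psd T d nu : (forall i, 0 <= d 0 i) -> psdmx (geod T d nu).
Proof.
move=> d0; apply/psdmxP; split=> [|v]; first exact: geod_herm.
by rewrite rq_geod sumr_ge0 // => i _; rewrite mulr_ge0 ?powR_ge0 ?normsq_ge0.
Qed.

Lemma rq_geod_gt0 T d nu v : T \in unitmx -> (forall i, 0 < d 0 i) ->
  v != 0 -> 0 < rq (geod T d nu) v.
Proof.
move=> uT d0 v0; rewrite rq_geod lt_neqAle eq_sym.
have term_ge0 i : true -> 0 <= d 0 i `^ nu * normsq ((T *m v) i 0).
  by rewrite mulr_ge0 ?powR_ge0 ?normsq_ge0.
rewrite sumr_ge0 // andbT psumr_eq0 //; apply: contraNN v0 => /allP Tv0.
suff Tv : T *m v = 0 by rewrite -(mulKmx uT v) Tv mulmx0.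
apply/matrixP => i j; rewrite ord1 [RHS]mxE; apply/eqP.
have := Tv0 i (mem_index_enum _); rewrite /= mulf_eq0 gt_eqF ?powR_gt0 //.
by rewrite normsq_eq0.
Qed.

Lemma geod_factor T d nu : T \in unitmx -> (forall i, 0 < d 0 i) ->
  exists2 S, S \in unitmx & geod T d nu = S^t* *m S.
Proof.
move=> uT d0; exists (rpow d (nu / 2) *m T).
  have := rpowM (nu / 2) (- (nu / 2)) d0; rewrite subrr rpow0 => /mulmx1_unit[].
  by move=> uD _; rewrite unitmx_mul uD.
rewrite adjmxM (hermP _ (rpow_herm _ _)) -mulmxA (mulmxA (rpow _ _)) rpowM //.
by rewrite -splitr mulmxA.
Qed.

(** The inverse of [geod T d nu] for invertible [T] and positive [d], as [geod_invP] shows. *)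
Definition geod_inv T d nu : 'M[C]_n :=
  invmx T *m rpow d (- nu) *m (invmx T)^t*.

Lemma mulmx_sandwich (U V V' D1 D2 : 'M[C]_n) T :
  T *m V = 1%:M -> V' *m U = 1%:M ->
  (U *m D1 *m T) *m (V *m D2 *m V') *m (U *m D1 *m T) =
  U *m (D1 *m D2 *m D1) *m T.
Proof.
move=> TV VU; rewrite -!mulmxA (mulmxA T) TV mul1mx (mulmxA V') VU mul1mx.
by [].
Qed.

Lemma mulmx_congr_inv (U V V' D1 D2 : 'M[C]_n) T :
  T *m V = 1%:M -> D1 *m D2 = 1%:M -> U *m V' = 1%:M ->
  (U *m D1 *m T) *m (V *m D2 *m V') = 1%:M.
Proof.
move=> TV DD UV; rewrite -!mulmxA (mulmxA T) TV mul1mx (mulmxA D1) DD mul1mx.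
exact: UV.
Qed.

Lemma adjmx_invr T : T \in unitmx -> (invmx T)^t* *m T^t* = 1%:M.
Proof. by move=> uT; rewrite -adjmxM mulmxV // trmx1 map_mx1. Qed.

Lemma adjmx_invl T : T \in unitmx -> T^t* *m (invmx T)^t* = 1%:M.
Proof. by move=> uT; rewrite -adjmxM mulVmx // trmx1 map_mx1. Qed.

Lemma geod_inv_sandwich T d mu nu : T \in unitmx -> (forall i, 0 < d 0 i) ->
  geod T d mu *m geod_inv T d nu *m geod T d mu = geod T d (mu + mu - nu).
Proof.
move=> uT d0; rewrite [LHS](mulmx_sandwich _ _ (mulmxV uT) (adjmx_invr uT)).
have e : mu + - nu + mu = mu + mu - nu by rewrite addrAC.
by rewrite (rpowM _ _ d0) (rpowM _ _ d0) e.
Qed.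

Lemma geod_invP T d nu : T \in unitmx -> (forall i, 0 < d 0 i) ->
  geod T d nu *m geod_inv T d nu = 1%:M.
Proof.
move=> uT d0; apply: (mulmx_congr_inv (mulmxV uT) _ (adjmx_invl uT)).
by rewrite rpowM // subrr rpow0.
Qed.

(** An instance of [riccati_le] with [P] at exponent [mu], [X] at the midpoint and [Q] at [nu];
    [geod_inv_sandwich] is the Riccati equation, as twice the midpoint minus [mu] is [nu]. *)
Lemma geod_le_mid T d T' d' mu nu : T \in unitmx -> T' \in unitmx ->
  (forall i, 0 < d 0 i) -> (forall i, 0 < d' 0 i) ->
  (forall v, rq (geod T d mu) v <= rq (geod T' d' mu) v) ->
  (forall v, rq (geod T d nu) v <= rq (geod T' d' nu) v) ->
  forall v, rq (geod T d ((mu + nu) / 2)) v <=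
            rq (geod T' d' ((mu + nu) / 2)) v.
Proof.
move=> uT uT' d0 d'0 le_mu le_nu.
have [S uS PS] := geod_factor mu uT d0.
have d0' i : 0 <= d 0 i by apply: ltW.
have e : (mu + nu) / 2 + (mu + nu) / 2 - mu = nu by field.
apply: (riccati_le uS PS (geod_psd _ _ d0') (geod_herm _ _ _)
  (geod_psd _ _ d0') (geod_herm _ _ _) _ (geod_invP _ uT d0)
  (geod_invP _ uT' d'0) le_mu (geod_inv_sandwich _ _ uT d0)
  (geod_inv_sandwich _ _ uT' d'0)).
  by move=> v; apply: rq_geod_gt0.
by rewrite e.
Qed.

Lemma continuous_rq_geod T d v : (forall i, 0 < d 0 i) ->
  continuous (fun nu => rq (geod T d nu) v).
Proof.
move=> d0 nu; under eq_fun do rewrite rq_geod.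
apply: cvg_big => [|i _]; first exact: add_continuous.
apply: cvgMl; rewrite /powR (gt_eqF (d0 i)).
apply: continuous_comp; last exact: continuous_expR.
by apply: cvgMl; exact: cvg_id.
Qed.

Lemma geod_le T d T' d' nu : T \in unitmx -> T' \in unitmx ->
  (forall i, 0 < d 0 i) -> (forall i, 0 < d' 0 i) ->
  (forall v, rq (geod T d 0) v <= rq (geod T' d' 0) v) ->
  (forall v, rq (geod T d 1) v <= rq (geod T' d' 1) v) ->
  0 <= nu <= 1 -> forall v, rq (geod T d nu) v <= rq (geod T' d' nu) v.
Proof.
move=> uT uT' d0 d'0 le0 le1 nu01 v.
pose good a := forall v, rq (geod T d a) v <= rq (geod T' d' a) v.
have good_mid a b : good a -> good b -> good ((a + b) / 2).
  exact: geod_le_mid.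
pose h x := rq (geod T' d' x) v - rq (geod T d x) v.
rewrite -subr_ge0 -/(h nu).
apply: (@midpoint_closed_ge0 R good h nu le0 le1 good_mid nu01) => [|a ga].
  by apply: cvgB; apply: continuous_rq_geod.
by rewrite /h subr_ge0; apply: ga.
Qed.

End Monotonicity.

(** * Entrywise limits and integrals *)

Section Entrywise.
Context {R : realType} {n : nat}.
Notation C := R[i].

(* Values outside [D] are irrelevant, e.g. for the integral over D = [0, 1]. *)
Definition linear_on (D : set R) (K : (R -> R) -> Prop) (L : (R -> R) -> R) :=
  [/\ K (fun=> 0) /\ L (fun=> 0) = 0,
      forall c f, K f -> K (fun t => c * f t) /\ L (fun t => c * f t) = c * L f,
      forall f g, K f -> K g ->
        K (fun t => f t + g t) /\ L (fun t => f t + g t) = L f + L g &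
      forall f g, (forall t, D t -> f t = g t) -> K f -> K g /\ L g = L f].

Context (D : set R) (K : (R -> R) -> Prop) (L : (R -> R) -> R)
  (linKL : linear_on D K L).

Lemma linear_on_sum (I : Type) (r : seq I) (F : I -> R -> R) :
  (forall i, K (F i)) ->
  K (fun t => \sum_(i <- r) F i t) /\
  L (fun t => \sum_(i <- r) F i t) = \sum_(i <- r) L (F i).
Proof.
have [L0 _ LD Leq] := linKL; move=> KF.
elim: r => [|i r [IHK IHL]].
  have [K0 L00] := L0; rewrite big_nil -L00.
  by apply: (Leq _ _ _ K0) => t _; rewrite big_nil.
have [KD LDi] := LD _ _ (KF i) IHK; rewrite big_cons -IHL -LDi.
by apply: (Leq _ _ _ KD) => t _; rewrite big_cons.
Qed.

Context (F : R -> 'M[C]_n) (F_herm : forall t, D t -> F t \is hermsymmx)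
  (KF : forall v, K (fun t => rq (F t) v)).

(** The combination is the one in [Re_entry] and [Im_entry], through which [K] passes from the forms
    to the entries. *)
Let KB (u v w : 'cV[C]_n) (c : R) :
  K (fun t => c * (rq (F t) u - rq (F t) v - rq (F t) w)).
Proof.
have [_ LZ LD Leq] := linKL; apply: (LZ c _ _).1.
have KN x : K (fun t => - 1 * rq (F t) x) by apply: (LZ _ _ (KF x)).1.
apply: (Leq _ _ _ (LD _ _ (LD _ _ (KF u) (KN v)).1 (KN w)).1).1 => t _.
by rewrite !mulN1r.
Qed.

Let KRe i j : K (fun t => complex.Re (F t i j)).
Proof.
have [_ _ _ Leq] := linKL; apply: (Leq _ _ _ (KB _ _ _ _)).1 => t /F_herm hF.
by rewrite Re_entry.
Qed.

Let KIm i j : K (fun t => complex.Im (F t i j)).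
Proof.
have [_ _ _ Leq] := linKL; apply: (Leq _ _ _ (KB _ _ _ _)).1 => t /F_herm hF.
by rewrite Im_entry.
Qed.

Lemma entrywise_herm : entrywise L F \is hermsymmx.
Proof.
have [_ LZ _ Leq] := linKL.
apply/hermP/matrixP => i j; rewrite !mxE.
have -> : L (fun t => complex.Re (F t j i)) = L (fun t => complex.Re (F t i j)).
  apply: (Leq _ _ _ (KRe i j)).2 => t /F_herm hF.
  by rewrite (herm_entry i j hF); case: (F t i j).
have -> : L (fun t => complex.Im (F t j i)) =
    - 1 * L (fun t => complex.Im (F t i j)).
  rewrite -(LZ _ _ (KIm i j)).2.
  apply: (Leq _ _ _ (LZ _ _ (KIm i j)).1).2 => t /F_herm hF.
  by rewrite (herm_entry i j hF); case: (F t i j) => a b /=; rewrite mulN1r.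
by apply/eqP; rewrite eq_complex /= mulN1r opprK !eqxx.
Qed.

(** By [rq_entries] the form is a real linear combination, with coefficients independent of [t], of
    the real and imaginary parts of the entries, so [L] passes through it. *)
Lemma rq_entrywise v : rq (entrywise L F) v = L (fun t => rq (F t) v).
Proof.
have [_ LZ LD Leq] := linKL; rewrite rq_entries.
pose a i j := complex.Re ((v i 0)^* * v j 0).
pose b i j := complex.Im ((v i 0)^* * v j 0).
pose G i j t := a i j * complex.Re (F t i j) + - b i j * complex.Im (F t i j).
have Gij i j : K (G i j) /\ L (G i j) =
    a i j * L (fun t => complex.Re (F t i j))
    - b i j * L (fun t => complex.Im (F t i j)).
  have [K1 L1] := LZ (a i j) _ (KRe i j).
  have [K2 L2] := LZ (- b i j) _ (KIm i j).
  by have [K3 L3] := LD _ _ K1 K2; split=> //; rewrite [LHS]L3 L1 L2 mulNr.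
have Gi i := linear_on_sum (index_enum 'I_n) (fun j => (Gij i j).1).
have [KG LG] := linear_on_sum (index_enum 'I_n) (fun i => (Gi i).1).
have -> : L (fun t => rq (F t) v) = L (fun t => \sum_i \sum_j G i j t).
  apply: (Leq _ _ _ KG).2 => t _; rewrite rq_entries.
  by apply: eq_bigr => i _; apply: eq_bigr => j _; rewrite /G mulNr.
rewrite LG; apply: eq_bigr => i _; rewrite (Gi i).2.
by apply: eq_bigr => j _; rewrite (Gij i j).2 !mxE.
Qed.

End Entrywise.

Section Functionals.
Context {R : realType}.
Notation mu := (@lebesgue_measure R).

Lemma linear_on_lim : linear_on setT (fun f : R -> R => cvg (f e @[e --> 0^'+]))
  (fun f : R -> R => lim (f e @[e --> 0^'+])).
Proof.
split.
- by split; [exact: is_cvg_cst | apply: cvg_lim => //; exact: cvg_cst].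
- move=> c f cf; split; first by apply: is_cvgM => //; exact: is_cvg_cst.
  by apply: cvg_lim => //; apply: cvgM => //; exact: cvg_cst.
- move=> f g cf cg; split; first exact: is_cvgD.
  exact: limD.
- move=> f g fg; rewrite (_ : f = g) //; apply/funext => t; exact: fg.
Qed.

Lemma linear_on_integral :
  linear_on `[0, 1] (fun f => mu.-integrable `[0, 1] (EFin \o f))
    (fun f => \int[mu]_(t in `[0, 1]) f t).
Proof.
split.
- by split; [exact: integrable0 | rewrite Rintegral_cst // mul0r].
- move=> c f intf; split; last by rewrite RintegralZl.
  by apply: eq_integrable (integrableZl _ c intf).
- move=> f g intf intg; split; last by rewrite RintegralD.
  by apply: eq_integrable (integrableD _ intf intg).
- move=> f g fg intf; split.
    by apply: eq_integrable intf => // t /set_mem Dt /=; rewrite fg.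
  by apply: eq_Rintegral => t /set_mem Dt; rewrite fg.
Qed.

End Functionals.

(** * The quadratic forms of the mean *)

Section Means.
Context {R : realType} {n : nat}.
Notation C := R[i].
Notation mu := (@lebesgue_measure R).
Implicit Types (A B : 'M[C]_n) (v : 'cV[C]_n).

Lemma conv01 (s t l : R) : 0 <= s <= 1 -> 0 <= t <= 1 -> 0 <= l <= 1 ->
  0 <= (1 - l) * s + l * t <= 1.
Proof.
move=> /andP[s0 s1] /andP[t0 t1] /andP[l0 l1].
have l1' : 0 <= 1 - l by rewrite subr_ge0.
rewrite addr_ge0 ?mulr_ge0 //= -[X in _ <= X](subrK l 1).
by apply: lerD; apply: ler_piMr.
Qed.

Lemma rq_shift A (e : R) v :
  rq (A + (e%:C)%:M) v = rq A v + e * \sum_i normsq (v i 0).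
Proof.
rewrite rqD; congr (_ + _).
have -> : (e%:C)%:M = rdiag (const_mx e) :> 'M[C]_n.
  by rewrite -diag_const_mx /rdiag map_const_mx.
by rewrite rq_diag mulr_sumr; apply: eq_bigr => i _; rewrite mxE.
Qed.

Lemma psd_shift A (e : R) : psdmx A -> 0 <= e -> psdmx (A + (e%:C)%:M).
Proof.
move=> /psdmxP[hA A0] e0; apply/psdmxP; split=> [|v].
  exact: (hermD hA (herm_scalar _ _)).
rewrite rq_shift addr_ge0 // mulr_ge0 // sumr_ge0 // => i _.
exact: normsq_ge0.
Qed.

(** On a kernel vector the form of [A] plus [e] times the squared norm would be 0, although both
    terms are nonnegative and the second is positive. *)
Lemma unitmx_shift A (e : R) : psdmx A -> 0 < e -> A + (e%:C)%:M \in unitmx.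
Proof.
move=> /psdmxP[hA A0] e0; rewrite unitmxE unitfE; apply/det0P => -[v v0 vM].
have: rq (A + (e%:C)%:M) (v^t*) = 0.
  by rewrite /rq trmxCK vM mul0mx mxE.
have S0 : 0 <= \sum_i normsq (v^t* i 0).
  by apply: sumr_ge0 => i _; apply: normsq_ge0.
rewrite rq_shift => /eqP; rewrite paddr_eq0 ?mulr_ge0 // ?(ltW e0) //.
rewrite mulf_eq0 (gt_eqF e0) /= => /andP[_].
rewrite psumr_eq0 => [/allP v_eq0|i _]; last exact: normsq_ge0.
apply/negP: v0; rewrite negbK; apply/eqP/matrixP => i j.
have := v_eq0 j (mem_index_enum _); rewrite /= normsq_eq0 !mxE ord1.
by rewrite conjC_eq0 => /eqP.
Qed.

(* [g] plays the role of nu |-> v^* (A #_nu B) v. *)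
Definition profile A B v (g : R -> R) := [/\ convex01 g,
  forall nu, 0 <= nu <= 1 -> 0 <= g nu, g 0 = rq A v, g 1 = rq B v &
  measurable_fun (`[0, 1] : set R) g].

(** For singular [B] some [d 0 i] vanish and the form may jump at exponent 0, so measurability is
    recorded instead of continuity. *)
Lemma profile_gmean_formula A B v : psdmx A -> A \in unitmx -> psdmx B ->
  profile A B v (fun nu => rq (gmean_formula nu A B) v).
Proof.
move=> pA uA pB.
have [T [d [uT d0 _ [AT BT] GT]]] := gmean_formula_geod pA uA pB.
have -> : (fun nu => rq (gmean_formula nu A B) v) =
    (fun nu => \sum_i d 0 i `^ nu * normsq ((T *m v) i 0)).
  by apply/funext => nu; rewrite GT rq_geod.
split.
- by apply: convex01_sum => i; [exact: normsq_ge0 | exact: convex01_powR].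
- move=> nu _; apply: sumr_ge0 => i _.
  by rewrite mulr_ge0 ?powR_ge0 ?normsq_ge0.
- by rewrite [in RHS]AT rq_geod.
- by rewrite [in RHS]BT rq_geod.
- apply: measurable_sum => i; apply: measurable_funM => //.
  by apply: measurable_funTS; exact: measurable_powRr.
Qed.

Lemma rq_gmean_formula_le A B A' B' nu v :
  psdmx A -> A \in unitmx -> psdmx B -> B \in unitmx ->
  psdmx A' -> A' \in unitmx -> psdmx B' -> B' \in unitmx ->
  (forall v, rq A v <= rq A' v) -> (forall v, rq B v <= rq B' v) ->
  0 <= nu <= 1 ->
  rq (gmean_formula nu A B) v <= rq (gmean_formula nu A' B') v.
Proof.
move=> pA uA pB uB pA' uA' pB' uB' AA' BB' nu01.
have [T [d [uT _ /(_ uB) d0 [AT BT] GT]]] := gmean_formula_geod pA uA pB.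
have [T' [d' [uT' _ /(_ uB') d'0 [AT' BT'] GT']]] :=
  gmean_formula_geod pA' uA' pB'.
rewrite GT GT'; apply: (geod_le uT uT' d0 d'0 _ _ nu01) => w.
  by rewrite -AT -AT'; apply: AA'.
by rewrite -BT -BT'; apply: BB'.
Qed.

(** By joint monotonicity the form is nondecreasing in [e > 0], and it is bounded below by 0. *)
Lemma cvg_gmean_shift A B nu v : psdmx A -> psdmx B -> 0 <= nu <= 1 ->
  cvg (rq (gmean_formula nu (A + (e%:C)%:M) (B + (e%:C)%:M)) v @[e --> 0^'+]).
Proof.
move=> pA pB nu01; apply: nondecreasing_at_right_is_cvgr; near=> x.
- move=> e e' /[!in_itv]/= /andP[e0 _] /andP[e'0 _] ee'.
  have S0 w : 0 <= \sum_i normsq ((w : 'cV[C]_n) i 0).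
    by apply: sumr_ge0 => i _; apply: normsq_ge0.
  have shift_le (M : 'M[C]_n) w : rq (M + (e%:C)%:M) w <= rq (M + (e'%:C)%:M) w.
    by rewrite !rq_shift lerD2l; apply: ler_wpM2r.
  exact: (rq_gmean_formula_le v (psd_shift pA (ltW e0)) (unitmx_shift pA e0)
    (psd_shift pB (ltW e0)) (unitmx_shift pB e0)
    (psd_shift pA (ltW e'0)) (unitmx_shift pA e'0)
    (psd_shift pB (ltW e'0)) (unitmx_shift pB e'0)
    (shift_le A) (shift_le B) nu01).
- exists 0 => _ [e /= /[!in_itv]/= /andP[e0 _] <-].
  have [_ + _ _ _] := profile_gmean_formula v (psd_shift pA (ltW e0))
    (unitmx_shift pA e0) (psd_shift pB (ltW e0)).
  exact.
Unshelve. all: by end_near. Qed.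

Lemma profile_lim A B v (q : R -> R -> R) :
  (forall e, 0 < e -> profile (A + (e%:C)%:M) (B + (e%:C)%:M) v (q e)) ->
  (forall nu, 0 <= nu <= 1 -> cvg (q e nu @[e --> 0^'+])) ->
  profile A B v (fun nu => lim (q e nu @[e --> 0^'+])).
Proof.
move=> Pq cq.
have lim_shift (M : 'M[C]_n) (f : R -> R) :
    (forall e, 0 < e -> f e = rq (M + (e%:C)%:M) v) ->
    lim (f e @[e --> 0^'+]) = rq M v.
  move=> fE; apply: cvg_lim => //.
  have : (rq M v + e * \sum_i normsq (v i 0)) @[e --> 0^'+] -->
      rq M v + 0 * \sum_i normsq (v i 0).
    apply: cvgD; first exact: cvg_cst.
    apply: cvgM; last exact: cvg_cst.
    by apply: cvg_at_right_filter; exact: cvg_id.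
  rewrite mul0r addr0; apply: cvg_trans; apply: near_eq_cvg.
  by near=> e; rewrite fE // rq_shift.
split.
- move=> s t l s01 t01 l01; have st01 := conv01 s01 t01 l01.
  apply: (ler_cvg_to (cq _ st01)).
    by apply: cvgD; (apply: cvgM; [exact: cvg_cst | exact: cq]).
  near=> e; have [cv _ _ _ _] : profile (A + (e%:C)%:M) (B + (e%:C)%:M) v (q e).
    exact: Pq.
  exact: cv.
- move=> nu nu01; apply: limr_ge; first exact: cq.
  near=> e; have [_ q0 _ _ _] : profile (A + (e%:C)%:M) (B + (e%:C)%:M) v (q e).
    exact: Pq.
  exact: q0.
- by apply: lim_shift => e /Pq[].
- by apply: lim_shift => e /Pq[].
(* Measurability survives limits of sequences, so the right limit is sampled at e = 1/(k+1). *)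
- pose h k nu := q (k.+1%:R^-1) nu.
  apply: (@measurable_fun_cvg _ _ _ _ h) => [k|nu].
    have k0 : 0 < k.+1%:R^-1 :> R by rewrite invr_gt0.
    by have [] := Pq _ k0.
  rewrite /= in_itv /= => nu01.
  have /cvg_at_rightP := cq nu nu01; apply; split=> [k|].
    by rewrite invr_gt0.
  exact: cvg_harmonic.
Unshelve. all: by end_near. Qed.

(** Agreement on [0, 1] suffices; for singular [A] the form of the mean is identified with a limit
    of forms only for such exponents. *)
Lemma eq_profile A B v (g h : R -> R) :
  (forall nu, 0 <= nu <= 1 -> g nu = h nu) -> profile A B v g ->
  profile A B v h.
Proof.
move=> gh [cg g0 gA gB mg]; split.
- move=> s t l s01 t01 l01.
  by rewrite -(gh _ s01) -(gh _ t01) -gh; [exact: cg | exact: conv01].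
- by move=> nu nu01; rewrite -gh // g0.
- by rewrite -gh // lexx ler01.
- by rewrite -gh // lexx ler01.
- apply: eq_measurable_fun mg => nu /set_mem /= /[!in_itv]/= nu01.
  exact: gh.
Qed.

Lemma gmean_profile A B : psdmx A -> psdmx B ->
  (forall nu, 0 <= nu <= 1 -> gmean nu A B \is hermsymmx) /\
  (forall v, profile A B v (fun nu => rq (gmean nu A B) v)).
Proof.
move=> pA pB; rewrite /gmean; have [uA|_] := boolP (A \in unitmx).
  split=> [nu _|v]; first exact: gmean_formula_herm.
  exact: profile_gmean_formula.
have KF nu v (nu01 : 0 <= nu <= 1) := @cvg_gmean_shift A B nu v pA pB nu01.
have hF nu (e : R) : setT e ->
    gmean_formula nu (A + (e%:C)%:M) (B + (e%:C)%:M) \is hermsymmx.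
  by move=> _; apply: gmean_formula_herm.
split=> [nu nu01|v].
  by apply: (entrywise_herm linear_on_lim (hF nu)) => v; exact: KF.
apply: eq_profile; last first.
  apply: (profile_lim (fun e e0 => profile_gmean_formula v
    (psd_shift pA (ltW e0)) (unitmx_shift pA e0) (psd_shift pB (ltW e0)))).
  by move=> nu nu01; apply: KF.
move=> nu nu01; rewrite (rq_entrywise linear_on_lim (hF nu)) // => w.
exact: KF.
Qed.

End Means.

(** * Integrability of the forms and the three Loewner inequalities *)

(** A measurable function on a set of finite measure, bounded: it is nonnegative and, by the chord
    estimate, at most [g 0 + g 1]. *)
Lemma profile_integrable (R : realType) n (A B : 'M[R[i]]_n) v g :
  profile A B v g -> (@lebesgue_measure R).-integrable `[0, 1] (EFin \o g).
Proof.
move=> [cg g0 _ _ mg]; apply: measurable_bounded_integrable => //.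
  by rewrite /= lebesgue_measure_itv /= lte_fin ltr01 -EFinD ltry.
exists (g 0 + g 1); split; first exact: num_real.
move=> M leM t /= /[!in_itv]/= t01; apply: le_trans (ltW leM).
rewrite ger0_norm ?g0 //; apply: le_trans (convex01_chord cg t01) _.
have /andP[t0 t1] := t01.
by apply: lerD; apply: ler_piMl; rewrite ?g0 ?lexx ?ler01 // gerBl.
Qed.

Theorem proposition4p3 (R : realType) (n : nat) (A B : 'M[R[i]]_n) (m : nat)
    (hA : psdmx A) (hB : psdmx B) (hm : (2 <= m)%N) :
  [/\ loewner_le
        (mxintegral01 (fun nu : R => gmean nu A B))
        (m%:R^-1 *: (\sum_(0 <= k < m.+1) gmean (k%:R / m%:R) A B
                     - 2^-1 *: (A + B))),
      loewner_le
        (m%:R^-1 *: (\sum_(0 <= k < m.+1) gmean (k%:R / m%:R) A B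
                     - 2^-1 *: (A + B)))
        (m%:R^-1 *: \sum_(0 <= k < m) gmean (k%:R / (m%:R - 1)) A B)
    & loewner_le
        (m%:R^-1 *: \sum_(0 <= k < m) gmean (k%:R / (m%:R - 1)) A B)
        (2^-1 *: (A + B))].
Proof.
have [hG pG] := gmean_profile hA hB.
have hG01 nu : `[0, 1]%classic nu -> gmean nu A B \is hermsymmx.
  by rewrite /= in_itv; exact: hG.
have iG v := profile_integrable (pG v).
have hI := entrywise_herm linear_on_integral hG01 iG.
have rqI v := rq_entrywise linear_on_integral hG01 iG v.
(* The complex scalars are exhibited as images of real ones, the form required by [hermZ] and
   [rqZ]. *)
have -> : m%:R^-1 = (m%:R^-1)%:C :> R[i] by rewrite fmorphV rmorph_nat.
have -> : 2^-1 = (2^-1)%:C :> R[i] by rewrite fmorphV rmorph_nat.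
have hAB : (2^-1)%:C *: (A + B) \is hermsymmx.
  by apply/hermZ/hermD; [case: hA | case: hB].
have m1 : m%:R - 1 = m.-1%:R :> R.
  by case: (m) hm => // k _; rewrite -natr1 addrK.
set S1 := \sum_(0 <= k < m.+1) _; set S2 := \sum_(0 <= k < m) _.
have hS1 : S1 \is hermsymmx.
  rewrite /S1 big_mkord; apply: herm_sum => k _; apply: hG.
  by apply: natr_div01; rewrite -ltnS.
have hS2 : S2 \is hermsymmx.
  rewrite /S2 big_mkord; apply: herm_sum => k _; apply: hG; rewrite m1.
  by apply: natr_div01; case: (m) hm k => // j _ k; rewrite -ltnS.
have rqS1 v : rq S1 v = \sum_(0 <= k < m.+1) rq (gmean (k%:R / m%:R) A B) v.
  exact: rq_sum.
have rqS2 v : rq S2 v = \sum_(0 <= k < m) rq (gmean (k%:R / (m%:R - 1)) A B) v.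
  exact: rq_sum.
clearbody S1 S2; have hM := hermZ m%:R^-1 (hermB hS1 hAB).
have hN := hermZ m%:R^-1 hS2.
(* All sides are Hermitian, so each inequality is tested on a vector [v], where the profile of [v]
   has endpoint values [rq A v] and [rq B v] and a scalar inequality for convex functions
   applies. *)
split.
- apply/(loewner_leP hI hM) => v; have [cg _ g0 g1 _] := pG v.
  rewrite rqI rqZ rqB rqZ rqD rqS1 -g0 -g1.
  exact: (integral_le_trapezoid (ltnW hm) cg (iG v)).
- apply/(loewner_leP hM hN) => v; have [cg _ g0 g1 _] := pG v.
  rewrite [rq (_ *: (_ - _)) v]rqZ [rq (_ *: S2) v]rqZ rqB rqZ rqD.
  rewrite rqS1 rqS2 -g0 -g1.
  exact: (refined_trapezoid_le hm cg).
- apply/(loewner_leP hN hAB) => v; have [cg _ g0 g1 _] := pG v.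
  rewrite [rq (_ *: S2) v]rqZ rqZ rqD rqS2 -g0 -g1.
  exact: (grid_le_average hm cg).
Qed.
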